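(* Let $q > 1$ be an odd integer and let $\Gamma$ be a primitive strongly regular graph with $v = (q+1)(q^2-q+1)$ vertices, valency $k$, eigenvalues $e^+ = \frac{q-1}{2}$ and $e^- = -\frac{q^2+1}{2}$, where the multiplicity $m^-$ of $e^-$ satisfies $ve^- = m^-(e^- - k)$. Then $\Gamma$ does not possess a Delsarte coclique if one of the following holds: (a) $q \equiv 5 \pmod 8$; or (b) $q = 2\ell p^e + 1$, where $p$ is a prime with $p \equiv 3 \pmod 4$, $e$ is a positive odd integer, $\ell$ is odd, and $\gcd(\ell,p) = 1$. Furthermore, if $q > 3$, then $\Gamma$ possesses at most two Delsarte cocliques.
   Context: A strongly regular graph with parameters $(v,k,\lambda,\mu)$ has $v$ vertices, is $k$-regular, two adjacent vertices have $\lambda$ common neighbours and two distinct non-adjacent vertices have $\mu$ common neighbours; its adjacency matrix has eigenvalues $k \ge e^+ \ge 0 > e^-$, and $m^-$ is the multiplicity of $e^-$. Primitive means the graph and its complement are connected. A Delsarte coclique is a set of pairwise non-adjacent vertices of size $\frac{ve^-}{e^- - k}$. *)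

(* Defs.v *)
From mathcomp Require Import all_boot all_order all_algebra all_field.
Set Implicit Arguments. Unset Strict Implicit. Unset Printing Implicit Defensive.
Import Order.TTheory GRing.Theory Num.Theory.
Local Open Scope ring_scope.

Definition simple_graph n (e : rel 'I_n) : Prop :=
  (forall x, ~~ e x x) /\ (forall x y, e x y = e y x).

Definition srg n (e : rel 'I_n) (v k lam mu : nat) : Prop :=
  [/\ simple_graph e, n = v,
      (forall x, #|[set y | e x y]| = k),
      (forall x y, e x y -> #|[set z | e x z && e y z]| = lam) &
      (forall x y, x != y -> ~~ e x y -> #|[set z | e x z && e y z]| = mu)].

Definition complement_rel n (e : rel 'I_n) : rel 'I_n :=
  fun x y => (x != y) && ~~ e x y.

Definition connected_graph n (e : rel 'I_n) : Prop :=
  forall x y, connect e x y.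

Definition primitive n (e : rel 'I_n) : Prop :=
  connected_graph e /\ connected_graph (complement_rel e).

Definition adjmx n (e : rel 'I_n) : 'M[algC]_n :=
  \matrix_(i, j) (e i j)%:R.

(* Multiplicity of an eigenvalue a (the adjacency matrix is symmetric, so this
   is the dimension of the eigenspace). *)
Definition eig_mult n (e : rel 'I_n) (a : algC) : nat :=
  \rank (eigenspace (adjmx e) a).

Definition coclique n (e : rel 'I_n) (S : {set 'I_n}) : bool :=
  [forall x in S, forall y in S, ~~ e x y].

Definition delsarte_coclique n (e : rel 'I_n) (k : nat) (eminus : algC)
  (S : {set 'I_n}) : bool :=
  coclique e S && ((#|S|%:R : algC) == n%:R * eminus / (eminus - k%:R)).

(* Main.v *)
(* Put q = 2h+1, K = 2h^2+2h+1 and c = q^2-q+1. The Gram matrix G = J + 2hI - 2A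
   satisfies G^2 = q(q+1)G. For a coclique S, comparing G with its compression to S
   gives a positive semidefinite residual of trace q v - q(q+1)|S|, so |S| <= c, and
   the residual vanishes when |S| = c. Hence the blocks N(x), x outside a Delsarte
   coclique S, have size K and meet pairwise in (h+1)^2 or h^2+h+1 points.

   If S and T are distinct Delsarte cocliques, S \ T and T \ S carry a symmetric
   design, and counting forces h+1 to divide 2; so for q > 3 there is at most one.

   For nonexistence, take N = 4 in case (a) and N = p^e in case (b). The vectors
   (N(x), 1) span a totally isotropic code C in (Z/N)^(c+1) for |y|^2 - t^2, and this
   form also vanishes on the orthogonal of C, by the design identities. Summing
   exp(2 pi i (|y|^2 - t^2) / N) over the whole space and averaging over C shows that
   g^c * conj g is a positive integer, where g is the quadratic Gauss sum mod N.
   But g = 2+2i for N = 4 with c = 5 mod 8, and conj g = -g for N = p^e with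
   c = 3 mod 4; in both cases g^c * conj g <= 0. *)
Require Import Defs.
From mathcomp Require Import all_boot all_order all_algebra all_field.
From mathcomp Require Import zify ring.
Import Order.TTheory GRing.Theory Num.Theory.
Local Open Scope ring_scope.
Set Implicit Arguments. Unset Strict Implicit. Unset Printing Implicit Defensive.

(** * Strongly regular graphs *)

Section Adjacency.
Variables (R : comNzRingType) (n : nat) (e : rel 'I_n) (v k lam mu : nat).
Hypothesis He : srg e v k lam mu.

Definition adj_mx : 'M[R]_n := \matrix_(i, j) (e i j)%:R.
Definition ones_mx : 'M[R]_n := const_mx 1.

Lemma sum_nat_of_bool (T : finType) (P : pred T) :
  \sum_x (P x)%:R = #|[set x | P x]|%:R :> R.
Proof.
rewrite -natr_sum; congr _%:R.
by rewrite -sum1_card [RHS]big_mkcond; apply: eq_bigr => x _; rewrite inE; case: (P x).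
Qed.

Lemma srg_adj_ones : adj_mx *m ones_mx = k%:R *: ones_mx.
Proof.
case: He => _ _ Hk _ _; apply/matrixP => i j; rewrite !mxE.
under eq_bigr do rewrite !mxE mulr1.
by rewrite sum_nat_of_bool Hk mulr1.
Qed.

Lemma srg_tr_adj : adj_mx^T = adj_mx.
Proof. by case: He => -[_ sym] _ _ _ _; apply/matrixP => i j; rewrite !mxE sym. Qed.

Lemma srg_tr_ones : ones_mx^T = ones_mx.
Proof. by apply/matrixP => i j; rewrite !mxE. Qed.

Lemma srg_ones_adj : ones_mx *m adj_mx = k%:R *: ones_mx.
Proof.
apply: trmx_inj; rewrite trmx_mul srg_tr_adj srg_tr_ones srg_adj_ones.
by rewrite linearZ /= srg_tr_ones.
Qed.

Lemma ones_ones : ones_mx *m ones_mx = n%:R *: ones_mx.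
Proof.
apply/matrixP => i j; rewrite !mxE; under eq_bigr do rewrite !mxE mulr1.
by rewrite sumr_const card_ord mulr1.
Qed.

Lemma srg_adj_adj : adj_mx *m adj_mx =
  k%:R%:M + lam%:R *: adj_mx + mu%:R *: (ones_mx - 1%:M - adj_mx).
Proof.
case: He => -[irr sym] _ Hk Hl Hm; apply/matrixP => i j; rewrite !mxE.
have -> : \sum_l adj_mx i l * adj_mx l j = #|[set z | e i z && e j z]|%:R.
  rewrite -sum_nat_of_bool; apply: eq_bigr => l _; rewrite !mxE (sym l j).
  by case: (e i l); case: (e j l); rewrite ?mulr0 ?mul0r ?mulr1.
have [<-|ne] := eqVneq i j.
  rewrite (negbTE (irr i)) mulr0 subrr subr0 mulr0 !addr0 -(Hk i); congr _%:R.
  by apply: eq_card => z; rewrite !inE andbb.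
have [eij|nij] := boolP (e i j).
  by rewrite (Hl _ _ eij) !mulr0n !subr0 subrr mulr0 add0r mulr1 addr0.
by rewrite (Hm _ _ ne nij) !mulr0n !subr0 mulr0 !add0r mulr1.
Qed.

End Adjacency.

(** Computing [w *m A *m J] in two ways shows that an eigenvector [w] for [a <> k] is killed by the
    all-ones matrix. The formula for the square of the adjacency matrix, applied to [w], then
    becomes a quadratic equation for [a]. *)
Lemma srg_eigen_eq n (e : rel 'I_n) (v k lam mu : nat) (a : algC) :
  srg e v k lam mu -> eigenvalue (adjmx e) a -> a != k%:R ->
  a ^+ 2 = k%:R - mu%:R + (lam%:R - mu%:R) * a.
Proof.
move=> He /eigenvalueP[w]; rewrite -[adjmx e]/(adj_mx algC e) => wA w0 ak.
have wJ : w *m ones_mx algC n = 0.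
  have : a *: (w *m ones_mx algC n) = k%:R *: (w *m ones_mx algC n).
    by rewrite (scalemxAl a w) -wA -mulmxA (srg_adj_ones algC He) scalemxAr.
  move/eqP; rewrite -subr_eq0 -scalerBl scaler_eq0 subr_eq0 (negbTE ak) /=.
  by move/eqP.
have := congr1 (mulmx w) (srg_adj_adj algC He).
rewrite mulmxA wA -scalemxAl wA !mulmxDr mul_mx_scalar -!scalemxAr wA.
rewrite !mulmxBr wJ wA mulmx1 => E.
apply/eqP; rewrite -subr_eq0.
suff : (a ^+ 2 - (k%:R - mu%:R + (lam%:R - mu%:R) * a)) *: w = 0.
  by move/eqP; rewrite scaler_eq0 (negbTE w0) orbF.
rewrite scalerBl expr2 -scalerA E.
apply/rowP => i; rewrite !mxE; ring.
Qed.

(** * The block design of a Delsarte coclique *)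

Section Projection.
Variables (n : nat) (G W : 'M[rat]_n) (theta : rat).
Hypotheses (trG : G^T = G) (trW : W^T = W).
Hypotheses (GG : G *m G = theta *: G) (WGW : W *m G *m W = W).

(** The residual [M] is symmetric and satisfies [M M = theta M], so its squared entries add up to
    [theta] times its trace. *)
Lemma sum_sqr_residual :
  \sum_i \sum_j ((G - G *m W *m G) i j) ^+ 2 =
  theta * (\tr G - theta * \tr (W *m G)).
Proof.
set M := G - _.
have trM : M^T = M by rewrite /M linearB /= !trmx_mul trG trW mulmxA.
have GWGG : G *m W *m G *m G = theta *: (G *m W *m G).
  by rewrite -mulmxA GG -scalemxAr.
have GGWG : G *m (G *m W *m G) = theta *: (G *m W *m G).
  by rewrite !mulmxA GG -!scalemxAl.
have GWGGWG : G *m W *m G *m (G *m W *m G) = theta *: (G *m W *m G).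
  rewrite -[LHS]mulmxA GGWG -scalemxAr; congr (_ *: _).
  by rewrite -!mulmxA (mulmxA W G) (mulmxA (W *m G)) WGW.
have MM : M *m M = theta *: M.
  rewrite /M mulmxBl !mulmxBr GG GGWG GWGG GWGGWG subrr subr0.
  by rewrite -scalerBr.
transitivity (\tr (M *m M)).
  apply: eq_bigr => i _; rewrite !mxE; apply: eq_bigr => j _.
  by rewrite expr2 -{2}trM [M^T _ _]mxE.
rewrite MM mxtraceZ /M linearB /=; congr (_ * (_ - _)).
by rewrite -mulmxA mxtrace_mulC -mulmxA GG -scalemxAr mxtraceZ.
Qed.

End Projection.

Section Coclique.
Variables (n h k lam mu : nat) (e : rel 'I_n) (S : {set 'I_n}).
Local Notation K := (2 * h ^ 2 + 2 * h + 1)%N.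
Local Notation theta := ((2 * h + 1) * (2 * h + 2))%:R.
Hypothesis h0 : (0 < h)%N.
Hypothesis He : srg e ((2 * h + 2) * (4 * h ^ 2 + 2 * h + 1))%N k lam mu.
Hypothesis lamE : (lam + K = mu + h)%N.
Hypothesis muE : (mu + h * K = k)%N.
Hypothesis cS : coclique e S.

(** The Seidel matrix [J - I - 2 A] shifted by [2 h + 1]. On vectors orthogonal to all-ones it is 0
    on the eigenspace of [h] and [theta] on that of [- K]. *)
Definition seidel_gram : 'M[rat]_n :=
  ones_mx rat n + (2 * h)%:R%:M - 2%:R *: adj_mx rat e.
Definition ind_mx : 'M[rat]_n := \matrix_(i, j) ((i == j) && (i \in S))%:R.
Definition ind2_mx : 'M[rat]_n := \matrix_(i, j) ((i \in S) && (j \in S))%:R.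
(** On a coclique the block of [seidel_gram] is [2 h I + J]; this is the inverse of that block,
    padded with zeros outside [S]. *)
Definition gram_inv : 'M[rat]_n :=
  (2 * h)%:R^-1 *: (ind_mx - (2 * h + #|S|)%:R^-1 *: ind2_mx).

Lemma seidel_gramE x y : seidel_gram x y =
  1 + (2 * h)%:R *+ (x == y) - 2 * (e x y)%:R.
Proof. by rewrite !mxE. Qed.

Lemma seidel_gram_tr : seidel_gram^T = seidel_gram.
Proof.
by rewrite /seidel_gram linearB linearD /= linearZ /= (srg_tr_adj rat He)
  srg_tr_ones tr_scalar_mx.
Qed.

Lemma seidel_gram_sqr : seidel_gram *m seidel_gram = theta *: seidel_gram.
Proof.
rewrite /seidel_gram mulmxBl mulmxDl !mulmxBr !mulmxDr -!scalemxAl -!scalemxAr.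
rewrite ones_ones (srg_adj_ones rat He) (srg_ones_adj rat He) (srg_adj_adj rat He).
rewrite !mul_mx_scalar !mul_scalar_mx.
have nE : n = ((2 * h + 2) * (4 * h ^ 2 + 2 * h + 1))%N by case: He.
have kE : k%:R = mu%:R + (h * K)%:R :> rat by rewrite -muE natrD.
have lE : lam%:R = mu%:R + h%:R - K%:R :> rat.
  by rewrite -natrD -lamE natrD addrK.
apply/matrixP => i j; rewrite !mxE kE lE [in n%:R]nE.
rewrite !(natrD, natrM, natrX); case: (i == j); rewrite /= ?mulr1n ?mulr0n; ring.
Qed.

Lemma ind_mxM (M : 'M[rat]_n) i j : (ind_mx *m M) i j = (i \in S)%:R * M i j.
Proof.
rewrite mxE (bigD1 i) //= big1 ?addr0 => [|l li]; rewrite !mxE ?eqxx //.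
by rewrite eq_sym (negbTE li) mul0r.
Qed.

Lemma tr_ind_mx : ind_mx^T = ind_mx.
Proof. by apply/matrixP => i j; rewrite !mxE eq_sym; case: eqVneq => [->|]. Qed.

Lemma tr_ind2_mx : ind2_mx^T = ind2_mx.
Proof. by apply/matrixP => i j; rewrite !mxE andbC. Qed.

Lemma mul_ind_mx (M : 'M[rat]_n) i j : (M *m ind_mx) i j = M i j * (j \in S)%:R.
Proof.
by rewrite -[M *m _]trmxK trmx_mul tr_ind_mx mxE ind_mxM mxE mulrC.
Qed.

Lemma ind_ind2 : ind_mx *m ind2_mx = ind2_mx.
Proof. by apply/matrixP => i j; rewrite ind_mxM !mxE -natrM mulnb andbA andbb. Qed.

Lemma ind2_ind : ind2_mx *m ind_mx = ind2_mx.
Proof. by apply: trmx_inj; rewrite trmx_mul tr_ind_mx tr_ind2_mx ind_ind2. Qed.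

Lemma ind_ind : ind_mx *m ind_mx = ind_mx.
Proof.
apply/matrixP => i j; rewrite ind_mxM !mxE -natrM mulnb andbCA andbb.
by [].
Qed.

Lemma sum_in_nat_of_bool (F : pred 'I_n) :
  \sum_(s in S) (F s)%:R = #|[set s in S | F s]|%:R :> rat.
Proof.
rewrite -natr_sum -sum1_card; congr _%:R.
rewrite [RHS]big_mkcond [LHS]big_mkcond; apply: eq_bigr => s _; rewrite inE.
by case: (s \in S); case: (F s).
Qed.

Lemma sum_ind (F : 'I_n -> rat) : \sum_i (i \in S)%:R * F i = \sum_(i in S) F i.
Proof.
by rewrite [RHS]big_mkcond; apply: eq_bigr => i _; case: (i \in S); rewrite ?mul1r ?mul0r.
Qed.

Lemma ind2_ind2 : ind2_mx *m ind2_mx = #|S|%:R *: ind2_mx.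
Proof.
apply/matrixP => i j; rewrite !mxE.
transitivity (\sum_l (l \in S)%:R * ((i \in S) && (j \in S))%:R : rat).
  apply: eq_bigr => l _; rewrite !mxE.
  by case: (i \in S); case: (l \in S); rewrite ?mul0r ?mulr0 ?mul1r.
by rewrite sum_ind sumr_const mulr_natl.
Qed.

Lemma seidel_gram_coclique x y : x \in S -> y \in S ->
  seidel_gram x y = 1 + (2 * h)%:R *+ (x == y).
Proof.
move=> xS yS; rewrite seidel_gramE.
have /forall_inP/(_ x xS)/forall_inP/(_ y yS)/negbTE -> := cS.
by rewrite mulr0 subr0.
Qed.

Lemma ind_gram_ind : ind_mx *m seidel_gram *m ind_mx = (2 * h)%:R *: ind_mx + ind2_mx.
Proof.
apply/matrixP => i j; rewrite mul_ind_mx ind_mxM [RHS]mxE [X in _ = X + _]mxE.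
rewrite [ind_mx i j]mxE [ind2_mx i j]mxE.
have [iS|] := boolP (i \in S); last by rewrite andbF !mul0r mulr0 addr0.
have [jS|jS] := boolP (j \in S).
  rewrite seidel_gram_coclique // mul1r mulr1 andbT mulr_natr addrC.
  by [].
case: eqVneq => [ij|_]; first by rewrite -ij iS in jS.
by rewrite !mulr0 addr0.
Qed.

Lemma gram_inv_tr : gram_inv^T = gram_inv.
Proof. by rewrite linearZ /= linearB /= linearZ /= tr_ind_mx tr_ind2_mx. Qed.

Lemma gram_inv_gram : gram_inv *m seidel_gram *m gram_inv = gram_inv.
Proof.
have h2 : (2 * h)%:R != 0 :> rat by rewrite pnatr_eq0; lia.
have s2 : (2 * h + #|S|)%:R != 0 :> rat by rewrite pnatr_eq0; lia.
rewrite /gram_inv; set t := (2 * h + #|S|)%:R^-1; set X := ind_mx - _.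
have XI : X *m ind_mx = X by rewrite mulmxBl ind_ind -scalemxAl ind2_ind.
have IX : ind_mx *m X = X by rewrite mulmxBr ind_ind -scalemxAr ind_ind2.
have XGX : X *m seidel_gram *m X = (2 * h)%:R *: X.
  rewrite -{1}XI -{2}IX !mulmxA -(mulmxA (X *m ind_mx)) -(mulmxA X).
  rewrite (mulmxA ind_mx seidel_gram) ind_gram_ind.
  have -> : X *m ((2 * h)%:R *: ind_mx + ind2_mx) = (2 * h)%:R *: ind_mx.
    rewrite mulmxDr -scalemxAr XI mulmxBl ind_ind2 -scalemxAl ind2_ind2.
    have tE : t * ((2 * h)%:R + #|S|%:R) = 1 by rewrite -natrD mulVf.
    apply/matrixP => i j; rewrite !mxE.
    set a := (X in X - t * _); set b := (X in t * X).
    transitivity ((2 * h)%:R * a + b * (1 - t * ((2 * h)%:R + #|S|%:R))); first by ring.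
    by rewrite tE subrr mulr0 addr0.
  by rewrite -scalemxAl IX.
rewrite -!scalemxAl -scalemxAr XGX scalerA scalerA mulfVK //.
Qed.

Definition gram_row (x : 'I_n) : rat := \sum_(s in S) seidel_gram x s.

Lemma seidel_gramC x y : seidel_gram x y = seidel_gram y x.
Proof. by rewrite -{1}seidel_gram_tr mxE. Qed.

Lemma seidel_gram_diag x : seidel_gram x x = (2 * h + 1)%:R.
Proof.
case: He => -[irr _] _ _ _ _.
by rewrite seidel_gramE (negbTE (irr x)) eqxx mulr0 subr0 natrD addrC.
Qed.

Lemma gram_row_coclique x : x \in S -> gram_row x = (2 * h + #|S|)%:R.
Proof.
move=> xS; rewrite /gram_row.
under eq_bigr => s sS do rewrite seidel_gram_coclique //.
rewrite big_split /= sumr_const (bigD1 x) //= eqxx big1 ?addr0 => [|s /andP[_ sx]].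
  by rewrite natrD addrC.
by rewrite eq_sym (negbTE sx).
Qed.

Lemma gram_inv_gramE x y : (gram_inv *m seidel_gram) x y =
  (2 * h)%:R^-1 * (x \in S)%:R *
    (seidel_gram x y - (2 * h + #|S|)%:R^-1 * gram_row y).
Proof.
rewrite /gram_inv -scalemxAl mxE -mulrA; congr (_ * _).
rewrite mulmxBl mxE [X in _ + X]mxE ind_mxM mulrBr -scalemxAl mulrCA.
congr (_ - _); rewrite mxE; congr (_ * _).
rewrite mxE mulr_sumr [RHS]big_mkcond.
apply: eq_bigr => s _; rewrite mxE seidel_gramC -mulnb natrM.
by case: (s \in S); rewrite ?mulr1 // mulr0 mul0r.
Qed.

Lemma trace_gram_inv_gram : \tr (gram_inv *m seidel_gram) = #|S|%:R.
Proof.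
have h2 : (2 * h)%:R != 0 :> rat by rewrite pnatr_eq0; lia.
have s2 : (2 * h + #|S|)%:R != 0 :> rat by rewrite pnatr_eq0; lia.
rewrite /mxtrace -sumr_const [RHS]big_mkcond; apply: eq_bigr => i _.
rewrite gram_inv_gramE; case: (boolP (i \in S)) => iS; last by rewrite mulr0 mul0r.
rewrite seidel_gram_diag gram_row_coclique // mulVf // mulr1.
by rewrite natrD addrK mulVf.
Qed.

(** The Schur complement of the block of [seidel_gram] on [S], padded with zeros. *)
Definition residual_mx := seidel_gram - seidel_gram *m gram_inv *m seidel_gram.

Lemma residual_norm :
  \sum_i \sum_j (residual_mx i j) ^+ 2 =
  theta * ((2 * h + 1)%:R * n%:R - theta * #|S|%:R).
Proof.
rewrite (sum_sqr_residual seidel_gram_tr gram_inv_tr seidel_gram_sqr gram_inv_gram).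
rewrite trace_gram_inv_gram; congr (_ * (_ - _)).
rewrite /mxtrace; under eq_bigr do rewrite seidel_gram_diag.
by rewrite sumr_const card_ord mulr_natr.
Qed.

(** The Hoffman bound, here from the fact that the sum of squares in [residual_norm] is
    nonnegative. *)
Lemma card_coclique_le : (#|S| <= 4 * h ^ 2 + 2 * h + 1)%N.
Proof.
have nE : n = ((2 * h + 2) * (4 * h ^ 2 + 2 * h + 1))%N by case: He.
have : 0 <= (theta * ((2 * h + 1)%:R * n%:R - theta * #|S|%:R) : rat).
  rewrite -residual_norm; apply: sumr_ge0 => i _; apply: sumr_ge0 => j _.
  exact: sqr_ge0.
rewrite pmulr_rge0 ?ltr0n ?muln_gt0 ?addn_gt0 ?orbT // subr_ge0 -!natrM ler_nat.
move: #|S| => s; rewrite nE.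
rewrite -mulnA leq_pmul2l ?addn_gt0 ?orbT // leq_pmul2l // addn_gt0 orbT //.
Qed.

Section MaximalCoclique.
Local Notation c := (4 * h ^ 2 + 2 * h + 1)%N.
Hypothesis kE : k = ((2 * h + 1) * K)%N.
Hypothesis sE : #|S| = c.

Lemma residual0 : seidel_gram = seidel_gram *m gram_inv *m seidel_gram.
Proof.
have nE : n = ((2 * h + 2) * c)%N by case: He.
apply/eqP; rewrite -subr_eq0; apply/eqP/matrixP => i j; rewrite [RHS]mxE.
have /eqP := residual_norm; rewrite sE [X in _ * X]( _ : _ = 0); last first.
  by rewrite nE -!natrM mulnA subrr.
rewrite mulr0 psumr_eq0 => [/allP/(_ i)|i' _]; last by apply: sumr_ge0 => *; apply: sqr_ge0.
rewrite mem_index_enum => /(_ isT); rewrite psumr_eq0 => [/allP/(_ j)|*]; last exact: sqr_ge0.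
by rewrite mem_index_enum => /(_ isT); rewrite sqrf_eq0 => /eqP.
Qed.

(** An entry of [residual0]. The size of [S] enters through [2 h + c = (2 h + 1)^2]. *)
Lemma gram_from_coclique x y : (2 * h)%:R * seidel_gram x y =
  \sum_(s in S) seidel_gram x s * seidel_gram y s
   - gram_row x * gram_row y / (2 * h + 1)%:R ^+ 2.
Proof.
have h2 : (2 * h)%:R != 0 :> rat by rewrite pnatr_eq0; lia.
have s2 : (2 * h + 1)%:R != 0 :> rat by rewrite pnatr_eq0; lia.
have tE : (2 * h + #|S|)%:R = (2 * h + 1)%:R ^+ 2 :> rat.
  by rewrite sE -natrX; congr _%:R; ring.
rewrite {1}residual0 -mulmxA mxE mulr_sumr.
rewrite {1}/gram_row !mulr_suml -sumrB [RHS]big_mkcond /=.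
apply: eq_bigr => s _; rewrite gram_inv_gramE tE.
case: (s \in S); last by rewrite mulr0 mul0r !mulr0.
rewrite (seidel_gramC s y) mulr1; move: (seidel_gram x s) (seidel_gram y s) (gram_row y) => a b r.
set u := (2 * h)%:R in h2 *; set t := (2 * h + 1)%:R in s2 *.
by clear tE; clearbody u t; field; rewrite h2 s2.
Qed.

(** At this valency [n + 2 h = 2 k], so the all-ones vector is in the kernel of [seidel_gram]. *)
Lemma gram_row_sum0 x : \sum_y seidel_gram x y = 0.
Proof.
have nE : n = ((2 * h + 2) * c)%N by case: He.
case: (He) => _ _ Hk _ _.
under eq_bigr do rewrite seidel_gramE.
rewrite sumrB big_split /= -mulr_sumr sum_nat_of_bool Hk kE sumr_const card_ord.
rewrite (bigD1 x) //= eqxx big1 ?addr0 => [|y]; last by rewrite eq_sym => /negbTE->.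
by rewrite mulr1n nE !(natrD, natrM, natrX); ring.
Qed.

Lemma seidel_gram_out x s : x \notin S -> s \in S ->
  seidel_gram x s = 1 - 2 * (e x s)%:R.
Proof.
move=> xS sS; rewrite seidel_gramE; case: eqVneq => [xs|_]; last by rewrite addr0.
by rewrite xs sS in xS.
Qed.

(** The entries from [x] to [S] are 1 or -1, so the diagonal case of [gram_from_coclique] reads
    [2 h (2 h + 1) = c - r^2 / (2 h + 1)^2] with [r] the row sum, and [c - 2 h (2 h + 1) = 1]. *)
Lemma sqr_gram_row x : x \notin S -> gram_row x ^+ 2 = (2 * h + 1)%:R ^+ 2.
Proof.
move=> xS; have s2 : (2 * h + 1)%:R != 0 :> rat by rewrite pnatr_eq0; lia.
have := gram_from_coclique x x; rewrite seidel_gram_diag.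
rewrite [X in X - _](_ : _ = c%:R); last first.
  rewrite -sE -sumr_const; apply: eq_bigr => s sS; rewrite seidel_gram_out //.
  by case: (e x s) => /=; ring.
move/eqP; rewrite -expr2 eq_sym subr_eq => /eqP E.
have /eqP : gram_row x ^+ 2 / (2 * h + 1)%:R ^+ 2 = 1.
  apply: (addrI ((2 * h)%:R * (2 * h + 1)%:R)); rewrite -E.
  by rewrite !(natrD, natrM, natrX); ring.
rewrite -[_ == 1](inj_eq (mulIf (expf_neq0 2 s2))) mulfVK ?expf_neq0 // mul1r.
by move/eqP.
Qed.

Lemma card_out : #|~: S| = ((2 * h + 1) * c)%N.
Proof.
have nE : n = ((2 * h + 2) * c)%N by case: He.
have := cardsC S; rewrite card_ord sE; set m := #|_| => cE.
by apply: (@addnI c); rewrite cE nE; ring.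
Qed.

(** Only the sign is open. All row sums add up to 0 and those in [S] contribute [c (2 h + 1)^2], so
    the [(2 h + 1) c] remaining ones must all take the negative value. *)
Lemma gram_row_out x : x \notin S -> gram_row x = - (2 * h + 1)%:R.
Proof.
move=> xS; have ge0 y : y \notin S -> 0 <= gram_row y + (2 * h + 1)%:R.
  move=> yS; rewrite -lerBlDr sub0r.
  have /eqP := sqr_gram_row yS; rewrite eqf_sqr => /orP[] /eqP ->; rewrite ?lexx //.
  by rewrite (le_trans (y := 0)) ?oppr_le0 ?ler0n.
have sum0 : \sum_(y | y \notin S) (gram_row y + (2 * h + 1)%:R) = 0.
  have : \sum_y gram_row y = 0.
    rewrite exchange_big big1 // => s _; rewrite -[RHS](gram_row_sum0 s).
    by apply: eq_bigr => y _; apply: seidel_gramC.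
  rewrite (bigID (mem S)) /=.
  under eq_bigr => s sS do rewrite gram_row_coclique //.
  rewrite sumr_const => /eqP; rewrite addrC addr_eq0 => /eqP E.
  rewrite big_split /= E.
  rewrite (eq_bigl (fun y => y \in ~: S)) => [|y]; last by rewrite inE.
  rewrite sumr_const card_out sE -!mulrnA.
  rewrite addrC; apply/eqP; rewrite subr_eq0 eqr_nat; apply/eqP; ring.
have /eqP := sum0; rewrite psumr_eq0 // => /allP/(_ x).
rewrite mem_index_enum xS => /(_ isT); rewrite implyTb addr_eq0 => /eqP //.
Qed.

Lemma coclique_nbrs x : x \notin S -> #|[set s in S | e x s]| = K.
Proof.
move=> xS; have := gram_row_out xS; rewrite /gram_row.
under eq_bigr => s sS do rewrite seidel_gram_out //.
rewrite sumrB sumr_const -mulr_sumr sE sum_in_nat_of_bool.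
set N := #|_| => /eqP; rewrite subr_eq eq_sym addrC subr_eq.
by rewrite -natrM -natrD eqr_nat => /eqP; lia.
Qed.

(** With the row sums known, the number of common neighbours is the only unknown left in
    [gram_from_coclique]. *)
Lemma coclique_common x y : x \notin S -> y \notin S -> x != y ->
  #|[set s in S | e x s && e y s]| = (if e x y then h ^ 2 + h + 1 else (h + 1) ^ 2)%N.
Proof.
move=> xS yS xy; have s2 : (2 * h + 1)%:R != 0 :> rat by rewrite pnatr_eq0; lia.
have := gram_from_coclique x y; rewrite !gram_row_out // mulrNN -expr2 divff ?expf_neq0 //.
rewrite seidel_gramE (negbTE xy) addr0.
have -> : \sum_(s in S) seidel_gram x s * seidel_gram y s =
  c%:R - 4 * K%:R + 4 * #|[set s in S | e x s && e y s]|%:R.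
  have nb z : z \notin S -> \sum_(s in S) (e z s)%:R = K%:R :> rat.
    by move=> zS; rewrite -(coclique_nbrs zS) sum_in_nat_of_bool.
  transitivity (\sum_(s in S) (1 - 2 * (e x s)%:R - 2 * (e y s)%:R
                                 + 4 * (e x s && e y s)%:R) : rat).
    apply: eq_bigr => s sS; rewrite !seidel_gram_out //.
    by case: (e x s); case: (e y s) => /=; ring.
  rewrite big_split !sumrB /= -!mulr_sumr !nb // sumr_const sE.
  by rewrite sum_in_nat_of_bool; ring.
set N := #|_|; move=> E.
suff : 4 * N%:R = 4 * (if e x y then h ^ 2 + h + 1 else (h + 1) ^ 2)%N%:R :> rat.
  by rewrite -!natrM => /eqP; rewrite eqr_nat => /eqP; lia.
have -> : 4 * N%:R = (2 * h)%:R * (1 - 2 * (e x y)%:R) + 1 - c%:R + 4 * K%:R :> rat.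
  by rewrite E; ring.
by case: (e x y); rewrite /= !(natrD, natrM, natrX); ring.
Qed.

End MaximalCoclique.
End Coclique.

(** * Parameters forced by the eigenvalues, and uniqueness of the coclique *)

Lemma srg_valency_eq n (e : rel 'I_n) (v k lam mu : nat) :
  srg e v k lam mu -> (0 < n)%N ->
  k%:Z * k%:Z = k%:Z + lam%:Z * k%:Z + mu%:Z * (n%:Z - 1 - k%:Z).
Proof.
move=> He n0; pose x := Ordinal n0.
have /(congr1 (fun M => (M *m ones_mx int n) x x)) := srg_adj_adj int He.
rewrite -mulmxA !mulmxDl -!scalemxAl !mulmxBl (srg_adj_ones int He) -scalemxAr.
by rewrite (srg_adj_ones int He) ones_ones mul1mx mul_scalar_mx !mxE !mulr1 !natz.
Qed.

Lemma srg_nonadj_le n (e : rel 'I_n) (v k lam mu : nat) :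
  srg e v k lam mu -> connected_graph (complement_rel e) -> (1 < n)%N -> (mu <= k)%N.
Proof.
move=> [_ _ Hk _ Hm] cc n1.
have n0 : (0 < n)%N by lia.
(* The first edge of a path in the complement joining two distinct vertices is a non-adjacent
   pair. *)
have /connectP[[|z p] /=] := cc (Ordinal n0) (Ordinal n1).
  by move=> _ [].
case/andP => /andP[xz nxz] _ _.
rewrite -(Hm _ _ xz nxz) -(Hk (Ordinal n0)); apply: subset_leq_card.
by apply/subsetP => y; rewrite !inE => /andP[].
Qed.

Section TwoEigenvalues.
Variables (n h k lam mu : nat) (e : rel 'I_n).
Local Notation K := (2 * h ^ 2 + 2 * h + 1)%N.
Local Notation c := (4 * h ^ 2 + 2 * h + 1)%N.
Hypothesis h0 : (0 < h)%N.
Hypothesis He : srg e ((2 * h + 2) * c)%N k lam mu.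
Hypothesis cc : connected_graph (complement_rel e).
Hypothesis eig1 : eigenvalue (adjmx e) h%:R.
Hypothesis eig2 : eigenvalue (adjmx e) (- K%:R).

(** [h] and [- K] are the two roots of the quadratic of [srg_eigen_eq]; the conclusions are its sum
    and product of roots. *)
Lemma two_eigenvalues_params : (lam + K = mu + h)%N /\ (mu + h * K = k)%N.
Proof.
have nE : n = ((2 * h + 2) * c)%N by case: He.
have n1 : (1 < n)%N by rewrite nE; nia.
have muk := srg_nonadj_le He cc n1.
have Kk : - K%:R != k%:R :> algC by rewrite eq_sym -addr_eq0 -natrD pnatr_eq0; lia.
have /eqP E2 := srg_eigen_eq He eig2 Kk.
have {}E2 : K%:Z ^+ 2 = k%:Z - mu%:Z - (lam%:Z - mu%:Z) * K%:Z.
  apply/eqP; rewrite -(eqr_int algC) -mulrN.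
  by move: E2; rewrite sqrrN !(rmorphD, rmorphN, rmorphM, rmorphXn) /= !(mulrN, rmorphN).
(* If [h = k], then [mu <= h], which makes the equation [E2] impossible by size. *)
have hk : h%:R != k%:R :> algC.
  rewrite eqr_nat; apply/eqP => hk; move: E2 muk; rewrite -hk; nia.
have /eqP E1 := srg_eigen_eq He eig1 hk.
have {}E1 : h%:Z ^+ 2 = k%:Z - mu%:Z + (lam%:Z - mu%:Z) * h%:Z.
  by apply/eqP; rewrite -(eqr_int algC); move: E1; rewrite !(rmorphD, rmorphN, rmorphM, rmorphXn).
have lm : lam%:Z - mu%:Z = h%:Z - K%:Z.
  have hK : h%:Z + K%:Z != 0 by lia.
  apply: (mulIf hK); rewrite mulrDr.
  have -> : (h%:Z - K%:Z) * (h%:Z + K%:Z) = h%:Z ^+ 2 - K%:Z ^+ 2 by ring.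
  by rewrite E1 E2; ring.
split; first by lia.
move: E1; rewrite lm => E1.
suff : mu%:Z + h%:Z * K%:Z = k%:Z by lia.
apply/eqP; rewrite -subr_eq0.
have -> : mu%:Z + h%:Z * K%:Z - k%:Z = h%:Z ^+ 2 - (k%:Z - mu%:Z + (h%:Z - K%:Z) * h%:Z) by ring.
by rewrite -E1 subrr.
Qed.

Lemma delsarte_params (S : {set 'I_n}) :
  delsarte_coclique e k (- K%:R) S -> #|S| = c /\ k = ((2 * h + 1) * K)%N.
Proof.
have [lamE muE] := two_eigenvalues_params.
have nE : n = ((2 * h + 2) * c)%N by case: He.
have n0 : (0 < n)%N by rewrite nE; nia.
case/andP => cS /eqP sE.
have Kk : - K%:R - k%:R != 0 :> algC.
  by rewrite -opprD oppr_eq0 -natrD pnatr_eq0; lia.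
have {}sE : (#|S| * (K + k) = n * K)%N.
  apply/eqP; rewrite -(eqr_nat algC) !natrM natrD; apply/eqP.
  apply: oppr_inj; rewrite -mulrN opprD sE mulfVK //; ring.
have {muE} muE : mu%:Z = k%:Z - h%:Z * K%:Z by lia.
have {}lamE : lam%:Z = mu%:Z + h%:Z - K%:Z by lia.
have := srg_valency_eq He n0; rewrite lamE muE (congr1 Posz nE) => E.
(* The valency equation has a second root, for which the coclique would have size [2 K], above the
   Hoffman bound [c]. *)
have : (k%:Z - ((2 * h + 1) * K)%N%:Z) * (k%:Z - (h * (2 * h + 1) ^ 2)%N%:Z) = 0.
  move/eqP: E; rewrite -subr_eq0 => /eqP <-; rewrite !(PoszD, PoszM); ring.
move/eqP; rewrite mulf_eq0 !subr_eq0 !eqz_nat => /orP[/eqP kE|/eqP kE].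
  split=> //.
  apply/eqP; rewrite -(@eqn_pmul2r (K + k)) ?addn_gt0 ?orbT // sE; apply/eqP.
  by rewrite [in LHS]nE kE; ring.
have [lamE' muE'] := two_eigenvalues_params.
have := card_coclique_le h0 He lamE' muE' cS.
have : #|S| = (2 * K)%N.
  apply/eqP; rewrite -(@eqn_pmul2r (K + k)) ?addn_gt0 ?orbT // sE; apply/eqP.
  by rewrite [in LHS]nE kE; ring.
lia.
Qed.


Lemma delsarte_unique (S T : {set 'I_n}) : (1 < h)%N ->
  delsarte_coclique e k (- K%:R) S -> delsarte_coclique e k (- K%:R) T -> S = T.
Proof.
move=> h1 dS dT; have [lamE muE] := two_eigenvalues_params.
have [sS kE] := delsarte_params dS; have [sT _] := delsarte_params dT.
have /andP[cS _] := dS; have /andP[cT _] := dT.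
have nadj (U : {set 'I_n}) x y : coclique e U -> x \in U -> y \in U -> e x y = false.
  by move=> /forall_inP cU xU yU; apply/negbTE; move: (cU _ xU) => /forall_inP/(_ _ yU).
have sym x y : e x y = e y x by case: He => -[].
apply/eqP; rewrite eqEcard sS sT leqnn andbT; apply/subsetP => x xS.
apply/negPn/negP => xT.
pose D := S :\: T.
have xD : x \in D by rewrite inE xS xT.
have nT := coclique_nbrs h0 He lamE muE cT kE sT.
have nS := coclique_nbrs h0 He lamE muE cS kE sS.
(* Double counting: each of the [K] neighbours [t] of [x] in [T] lies outside [S], and its [K]
   neighbours in [S] all lie in [D] because [T] is a coclique. *)
have E : (\sum_(y in D) #|[set t in T | e x t && e y t]| = K * K)%N.
  transitivity (\sum_(t in [set t in T | e x t]) K)%N; last first.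
    by rewrite sum_nat_const nT.
  transitivity (\sum_(y in D) \sum_(t in [set t in T | e x t]) (e y t : nat))%N.
    apply: eq_bigr => y _; rewrite -sum1_card big_mkcond [RHS]big_mkcond /=.
    by apply: eq_bigr => t _; rewrite !inE; case: (t \in T) (e x t) (e y t) => [] [] [].
  rewrite exchange_big; apply: eq_bigr => t; rewrite inE => /andP[tT xt].
  have tS : t \notin S by apply/negP => tS; rewrite (nadj S) in xt.
  rewrite -(nS _ tS) -sum1_card big_mkcond [RHS]big_mkcond /=.
  apply: eq_bigr => y _; rewrite !inE sym.
  have [yT|] := boolP (y \in T); last by case: (y \in S) (e t y) => [] [].
  by rewrite (nadj T) ?andbF.
have : ((#|D| - 1) * (h + 1) ^ 2 + K = K * K)%N.
  rewrite -E (bigD1 x) //= addnC; congr (_ + _)%N.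
    by rewrite -(nT _ xT); apply: eq_card => t; rewrite !inE andbb.
  rewrite (cardsD1 x D) xD addKn -sum_nat_const [RHS](eq_bigl (fun y => y \in D :\ x)); last first.
    by move=> y; rewrite !inE andbC.
  apply: eq_bigr => y; rewrite !inE => /and3P[yx yT yS].
  by rewrite (coclique_common h0 He lamE muE cT kE sT) 1?eq_sym // (nadj S).
have D0 : (0 < #|D|)%N by apply/card_gt0P; exists x.
move: D0; rewrite -subn_gt0; move: (#|D| - 1)%N => a _ aE.
(* Since [K - 1 = 2 h (h + 1)], the count gives [a (h + 1) = 2 h K], and [2 h K + 2] is a multiple
   of [h + 1]. *)
have {}aE : (a * (h + 1) + 2 = (4 * h ^ 2 + 2) * (h + 1))%N.
  apply/eqP; rewrite -(@eqn_pmul2r (h + 1)) ?addn_gt0 ?orbT //; apply/eqP.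
  apply: (@addIn K).
  have -> : ((a * (h + 1) + 2) * (h + 1) + K = a * (h + 1) ^ 2 + K + 2 * (h + 1))%N by ring.
  by rewrite aE; ring.
have : (h + 1 %| a * (h + 1) + 2)%N by rewrite aE dvdn_mull.
by rewrite dvdn_addr ?dvdn_mull // => /dvdn_leq => /(_ isT); lia.
Qed.

End TwoEigenvalues.

(** * The coclique as point set of an abstract design *)

Section DelsarteDesign.
Variables (n h k lam mu : nat) (e : rel 'I_n) (S : {set 'I_n}).
Local Notation K := (2 * h ^ 2 + 2 * h + 1)%N.
Local Notation c := (4 * h ^ 2 + 2 * h + 1)%N.
Hypothesis h0 : (0 < h)%N.
Hypothesis He : srg e ((2 * h + 2) * c)%N k lam mu.
Hypothesis lamE : (lam + K = mu + h)%N.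
Hypothesis muE : (mu + h * K = k)%N.
Hypothesis cS : coclique e S.
Hypothesis kE : k = ((2 * h + 1) * K)%N.
Hypothesis sE : #|S| = c.

Let P := {s : 'I_n | s \in S}.
Let B := {x : 'I_n | x \in ~: S}.
Let inc (x : B) (s : P) := e (val x) (val s).

Let sum_P (F : pred 'I_n) : (\sum_(s : P) F (val s) = #|[set s in S | F s]|)%N.
Proof.
rewrite -(big_sub (mem S) (fun s => nat_of_bool (F s))) -sum1_card [RHS]big_mkcond [LHS]big_mkcond /=.
by apply: eq_bigr => s _; rewrite inE; case: (s \in S); case: (F s).
Qed.

Let sum_B (F : pred 'I_n) : (forall x, x \in S -> ~~ F x) ->
  (\sum_(x : B) F (val x) = #|[set x | F x]|)%N.
Proof.
move=> FS; rewrite -(big_sub (mem (~: S)) (fun x => nat_of_bool (F x))).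
rewrite -sum1_card [RHS]big_mkcond [LHS]big_mkcond /=.
apply: eq_bigr => x _; rewrite !inE.
by have [/FS/negbTE->|_] := boolP (x \in S); case: (F x).
Qed.

Let nadj s t : s \in S -> t \in S -> ~~ e t s.
Proof. by move=> sS tS; move: cS => /forall_inP/(_ t tS)/forall_inP/(_ s sS). Qed.

(** Points are the vertices of [S], blocks the vertices outside. Neighbours of points are always
    blocks, so the point degrees and pair counts are [k] and [mu]. *)
Lemma delsarte_design : exists (P B : finType) (inc : B -> P -> bool),
  [/\ #|P| = c, #|B| = ((2 * h + 1) * c)%N,
      (forall s, \sum_x inc x s = (2 * h + 1) * K)%N,
      (forall s t, s != t -> \sum_x (inc x s && inc x t) = (h + 1) * K)%N &
      (forall x, \sum_s inc x s = K)%N /\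
      (forall x y, x != y ->
        (\sum_s (inc x s && inc y s) = h ^ 2 + h + 1)%N \/
        (\sum_s (inc x s && inc y s) = (h + 1) ^ 2)%N)].
Proof.
have [[_ sym] _ Hk _ Hm] := He.
have outS (x : B) : val x \notin S by have := valP x; rewrite inE.
exists P, B, inc; split.
- by rewrite card_sig -sE; apply: eq_card => s; rewrite !inE.
- rewrite card_sig -(card_out He sE); apply: eq_card => s; by rewrite !inE.
- move=> s; rewrite (sum_B (F := e^~ (val s))).
    by rewrite -kE -(Hk (val s)); apply: eq_card => x; rewrite !inE sym.
  by move=> x xS; apply: nadj => //; apply: valP.
- move=> s t st; rewrite (sum_B (F := fun x => e x (val s) && e x (val t))).
    have <- : mu = ((h + 1) * K)%N by nia.
    rewrite -(Hm (val s) (val t)) //.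
      by apply: eq_card => x; rewrite !inE (sym x) (sym x).
    by apply: nadj; apply: valP.
  by move=> x xS; rewrite negb_and nadj ?orbT //; apply: valP.
split.
  by move=> x; rewrite (sum_P (e (val x))) (coclique_nbrs h0 He lamE muE cS kE sE).
move=> x y xy; rewrite (sum_P (fun s => e (val x) s && e (val y) s)).
rewrite (coclique_common h0 He lamE muE cS kE sE) //.
by case: ifP; [left | right].
Qed.
End DelsarteDesign.

(** * Gauss sums and self-dual codes *)

Section SelfDualCode.
Variables (R : finComNzRingType) (psi : R -> algC).
Hypothesis psiD : forall a b, psi (a + b) = psi a * psi b.
Hypothesis psi0 : psi 0 = 1.
Hypothesis psi_nondeg : forall a, a != 0 -> exists b, psi (a * b) != 1.

Lemma psi_sum (I : finType) (F : I -> R) : psi (\sum_i F i) = \prod_i psi (F i).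
Proof. by apply: (big_morph psi psiD psi0). Qed.

(** Orthogonality of characters: the shift by [b] multiplies the sum by [psi (a * b) <> 1]. *)
Lemma sum_psi a : \sum_z psi (a * z) = #|R|%:R *+ (a == 0).
Proof.
have [->|a0] := eqVneq a 0.
  by under eq_bigr do rewrite mul0r psi0; rewrite sumr_const.
have [b pb] := psi_nondeg a0; apply/eqP.
suff /eqP : (psi (a * b) - 1) * \sum_z psi (a * z) = 0.
  by rewrite mulf_eq0 subr_eq0 (negbTE pb).
rewrite mulrBl mul1r mulr_sumr [X in _ - X](reindex_inj (addrI b)) -sumrB.
by rewrite big1 // => z _; rewrite -psiD mulrDr subrr.
Qed.

Variables (P B : finType) (a : B -> P -> R).
Local Notation V := ({ffun P -> R} * R)%type.
Let Q (y : V) : R := \sum_i y.1 i ^+ 2 - y.2 ^+ 2.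
Let word (z : {ffun B -> R}) : V := ([ffun i => \sum_x z x * a x i], \sum_x z x).
(** Orthogonality to the rows [(a x, 1)] for the polar form of [Q]. Its factor 2 cannot be cancelled
    modulo 4. *)
Let perp (y : V) := [forall x, 2 * (\sum_i a x i * y.1 i - y.2) == 0].

Hypothesis norm_rows : forall x, \sum_i a x i * a x i = 1.
Hypothesis inner_rows : forall x y, 2 * (\sum_i a x i * a y i) = 2.
Hypothesis perp_isotropic : forall y, perp y -> Q y = 0.

(** Adding one row at a time, the diagonal term is controlled by [norm_rows]; the cross term carries
    a factor 2, so [inner_rows] suffices. *)
Let isotropic z : Q (word z) = 0.
Proof.
rewrite /Q /=; under eq_bigr do rewrite ffunE.
apply/eqP; rewrite subr_eq0; apply/eqP.
elim: (index_enum B) => [|x r IH].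
  by under eq_bigr do rewrite big_nil; rewrite big1 ?big_nil => [|*]; rewrite expr0n.
under eq_bigr do rewrite big_cons.
rewrite big_cons [RHS]sqrrD -IH -[z x ^+ 2]mulr1 -(norm_rows x).
have -> : (z x * \sum_(j <- r) z j) *+ 2 =
    \sum_i 2 * (z x * a x i * \sum_(j <- r) z j * a j i).
  rewrite -[LHS]mulr_natl mulr_sumr mulr_sumr.
  under [RHS]eq_bigr do rewrite mulr_sumr mulr_sumr.
  rewrite exchange_big; apply: eq_bigr => j _ /=.
  transitivity (z x * z j * 2); first by ring.
  by rewrite -[X in _ * X = _](inner_rows x j) mulr_sumr mulr_sumr; apply: eq_bigr => i _; ring.
by rewrite mulr_sumr -!big_split; apply: eq_bigr => i _ /=; ring.
Qed.

Let polarQ y z : Q (y + word z) =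
  Q y + \sum_x 2 * (\sum_i a x i * y.1 i - y.2) * z x.
Proof.
have -> : \sum_x 2 * (\sum_i a x i * y.1 i - y.2) * z x =
    2 * (\sum_i y.1 i * (word z).1 i) - 2 * (y.2 * (word z).2).
  transitivity (2 * (\sum_x z x * (\sum_i a x i * y.1 i)) - 2 * (y.2 * \sum_x z x)).
    by rewrite !mulr_sumr -sumrB; apply: eq_bigr => x _; ring.
  congr (2 * _ - _); under eq_bigr do rewrite mulr_sumr.
  rewrite exchange_big; apply: eq_bigr => i _; rewrite ffunE mulr_sumr.
  by apply: eq_bigr => x _; ring.
rewrite -[RHS]addr0 -[X in _ = _ + X](isotropic z) /Q /=.
under eq_bigr do rewrite ffunE sqrrD.
rewrite !big_split /=.
ring.
Qed.

(** The left side is the sum of [psi (Q y)] over all of [V]. After averaging over translations by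
    codewords, a vector [y] outside the orthogonal of the code contributes 0, and one inside
    contributes [psi 0 = 1]. *)
Lemma gauss_sum_self_dual :
  (\sum_r psi (r ^+ 2)) ^+ #|P| * (\sum_r psi (- r ^+ 2)) = #|[pred y | perp y]|%:R.
Proof.
transitivity (\sum_y psi (Q y)).
  rewrite -(pair_bigA _ (fun (y : {ffun P -> R}) t => psi (\sum_i y i ^+ 2 - t ^+ 2))) /=.
  rewrite -prodr_const bigA_distr_bigA mulr_suml; apply: eq_bigr => y _.
  rewrite mulr_sumr; apply: eq_bigr => t _.
  by rewrite psiD psi_sum.
have W0 : #|{ffun B -> R}|%:R != 0 :> algC.
  by rewrite pnatr_eq0 -lt0n; apply/card_gt0P; exists [ffun=> 0].
apply: (mulfI W0).
(* Averaging over coefficient vectors [z] instead of codewords avoids counting the code. *)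
transitivity (\sum_(z : {ffun B -> R}) \sum_(y : V) psi (Q (y + word z))).
  rewrite mulr_natl -sumr_const; apply: eq_bigr => z _.
  by rewrite [LHS](reindex_inj (@addIr (V : zmodType) (word z))).
rewrite exchange_big mulr_natr -sumr_const [RHS]big_mkcond /=.
apply: eq_bigr => y _; rewrite inE.
under eq_bigr => z _ do rewrite polarQ psiD psi_sum.
rewrite -mulr_sumr -(bigA_distr_bigA (fun x r => psi (2 * (\sum_i a x i * y.1 i - y.2) * r))).
rewrite /=; under eq_bigr do rewrite sum_psi.
case: (boolP (perp y)) => [py|].
  rewrite perp_isotropic // psi0 mul1r card_ffun natrX -prodr_const.
  by apply: eq_bigr => x _; rewrite (forallP py x).
case/forallPn => x px; rewrite (bigD1 x) //= (negbTE px) mul0r mulr0.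
by [].
Qed.
End SelfDualCode.

(** * Quadratic Gauss sums modulo prime powers *)

Definition gauss_sum (N : nat) (z : algC) : algC := \sum_(0 <= i < N) z ^+ (i ^ 2).

Lemma conj_unity_root (N : nat) (z : algC) : (0 < N)%N -> z ^+ N = 1 -> z^* = z^-1.
Proof.
move=> N0 zN; have /eqP : `|z| ^+ N = 1 by rewrite -normrX zN normr1.
rewrite pexprn_eq1 ?normr_ge0 // (gtn_eqF N0) /= => /eqP z1.
by rewrite invC_norm z1 expr1n invr1 mul1r.
Qed.

Lemma gauss_sum_conj (N : nat) (z : algC) : (0 < N)%N -> z ^+ N = 1 ->
  (gauss_sum N z)^* = gauss_sum N z^-1.
Proof.
move=> N0 zN; rewrite /gauss_sum rmorph_sum; apply: eq_bigr => i _.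
by rewrite rmorphXn /= (conj_unity_root N0 zN).
Qed.

Lemma geometric_root_sum (N : nat) (x : algC) : x ^+ N = 1 -> x != 1 ->
  \sum_(0 <= i < N) x ^+ i = 0.
Proof.
move=> xN x1; apply/eqP; rewrite big_mkord.
suff /eqP : (x - 1) * \sum_(i < N) x ^+ i = 0 by rewrite mulf_eq0 subr_eq0 (negbTE x1).
by rewrite -subrX1 xN subrr.
Qed.

(** Write the index as [a + b M] with [M = p^(e+1)]. The sum over [b] is geometric in a [p]-th root
    of unity and vanishes unless [p] divides [2 a], that is [a]. *)
Lemma gauss_sum_step (p e : nat) (z : algC) : prime p -> odd p ->
  (p ^ e.+2).-primitive_root z -> gauss_sum (p ^ e.+2) z = p%:R * gauss_sum (p ^ e) (z ^+ (p ^ 2)).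
Proof.
move=> pp op pz; pose M := (p ^ e.+1)%N; have p0 := prime_gt0 pp.
have pM : (p ^ e.+2 = p * M)%N by rewrite [LHS]expnS.
have pw : p.-primitive_root (z ^+ M).
  have := dvdn_prim_root pz (m := p).
  by rewrite pM => /(_ (dvdn_mulr _ (dvdnn p))); rewrite mulKn.
rewrite /gauss_sum pM big_nat_mul.
transitivity (\sum_(0 <= b < p) \sum_(0 <= a < M) z ^+ (a ^ 2) * (z ^+ M) ^+ (2 * a * b)).
  apply: eq_bigr => b _; rewrite -{1}[(b * M)%N]add0n big_addn.
  have -> : (b.+1 * M - b * M = M)%N by rewrite -mulnBl subSnn mul1n.
  apply: eq_bigr => a _; rewrite -exprM -exprD.
  apply/eqP; rewrite (eq_prim_root_expr pz) pM.
  have -> : ((a + b * M) ^ 2 = a ^ 2 + M * (2 * a * b) + b ^ 2 * p ^ e * (p * M))%N.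
    have MM : (M * M = p ^ e * (p * M))%N by rewrite {1}/M expnSr -mulnA.
    by rewrite -(mulnA (b ^ 2)%N) -MM; ring.
  by rewrite addnC modnMDl.
rewrite exchange_big.
transitivity (\sum_(0 <= a < M) (if (p %| a)%N then p%:R * z ^+ (a ^ 2) else 0)).
  apply: eq_bigr => a _; rewrite -mulr_sumr.
  under eq_bigr do rewrite exprM.
  case: ifP => pa.
    have -> : (z ^+ M) ^+ (2 * a) = 1.
      by apply/eqP; rewrite -(prim_order_dvd pw) dvdn_mull.
    under eq_bigr do rewrite expr1n.
    by rewrite sumr_const_nat subn0 mulrC.
  rewrite geometric_root_sum ?mulr0 //.
    by rewrite exprAC (prim_expr_order pw) expr1n.
  rewrite -(prim_order_dvd pw) Euclid_dvdM // pa orbF.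
  by apply/negP => /(dvdn_leq (isT : 0 < 2)%N); case: p pp op {pz pM pw pa M p0} => [|[|[|]]].
(* In each block of [p] consecutive values of [a] only the first, a multiple of [p], survives. *)
rewrite mulr_sumr /M expnSr big_nat_mul; apply: eq_bigr => a _.
rewrite big_ltn ?ltn_pmul2r // dvdn_mull // big_nat_cond big1 ?addr0.
  by rewrite [LHS]addr0 -exprM expnMn mulnC.
move=> i /andP[/andP[ai ia] _]; rewrite ifF //; apply/negP => /dvdnP[d dE].
by move: ai ia; rewrite dE ltn_pmul2r // ltn_pmul2r //; lia.
Qed.

Lemma sum_Fp (p : nat) (F : nat -> algC) : prime p ->
  \sum_(0 <= i < p) F i = \sum_(r : 'F_p) F r.
Proof. by move=> pp; rewrite -{1}(Fp_cast pp) big_mkord. Qed.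

(* Since (p - 1) / 2 is odd, x ^ ((p + 3) / 2) = (x / p) * x ^ 2 permutes the field
   and agrees with x ^ 2 up to sign. *)
Lemma gauss_sum_prime (p : nat) (z : algC) : prime p -> (p %% 4 = 3)%N ->
  p.-primitive_root z -> (gauss_sum p z)^* = - gauss_sum p z.
Proof.
move=> pp p4 pz; apply/eqP; rewrite -addr_eq0 addrC.
rewrite gauss_sum_conj ?prime_gt0 ?(prim_expr_order pz) //; apply/eqP.
 rewrite /gauss_sum -big_split /= (sum_Fp _ pp).
(* [psi] is even, so it does not see the sign [x ^ m = 1] or [-1] that separates [x ^ (m + 2)] from
   [x ^ 2]. *)
pose psi (r : 'F_p) : algC := z ^+ r + z^-1 ^+ r.
have zE i : z ^+ (i %% p) = z ^+ i by rewrite prim_expr_mod.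
have ziE i : z^-1 ^+ (i %% p) = z^-1 ^+ i by rewrite !exprVn zE.
have z0 : z != 0.
  by apply/eqP => z0; have := prim_expr_order pz; move/eqP; rewrite z0 expr0n (gtn_eqF (prime_gt0 pp)) eq_sym oner_eq0.
have modFp i : (i %% (Zp_trunc (pdiv p)).+2 = i %% p)%N by rewrite Fp_cast.
have zD (r s : 'F_p) : z ^+ (r + s)%R = z ^+ r * z ^+ s by rewrite -exprD -[RHS]zE -modFp.
have psiN r : psi (- r) = psi r.
  have e1 : z^-1 ^+ r = z ^+ (- r)%R.
    rewrite exprVn; apply: (mulfI (expf_neq0 r z0)); rewrite mulfV ?expf_neq0 //.
    by rewrite -zD subrr.
  have e2 : z^-1 ^+ (- r)%R = z ^+ r by rewrite exprVn -e1 exprVn invrK.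
  by rewrite /psi e1 e2 addrC.
have pK (x : 'F_p) s : x ^+ (1 + s * p.-1) = x.
  elim: s => [|s IH]; first by rewrite mul0n expr1.
  have pE : p = p.-1.+1 by have := prime_gt0 pp; lia.
  rewrite mulSn addnCA exprD IH -exprSr -pE.
  by have := expf_card x; rewrite card_Fp.
pose m := (p.-1 %/ 2)%N.
have phi_inj : injective (fun x : 'F_p => x ^+ (m + 2)).
  (* [t] inverts the exponent [m + 2] modulo [p - 1], explicitly for [p = 8 i + 3] and
     [p = 8 i + 7]. *)
  have [t [s ts]] : exists t s, ((m + 2) * t = 1 + s * p.-1)%N.
    have : (p %% 8 = 3 \/ p %% 8 = 7)%N by lia.
    have := divn_eq p 8; set i := (p %/ 8)%N; rewrite /m => pE [] p8; rewrite p8 in pE; rewrite pE.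
      exists (2 * i + 1)%N, (i + 1)%N.
      have -> : ((i * 8 + 3).-1 = (4 * i + 1) * 2)%N by lia.
      by rewrite mulnK //; ring.
    exists (6 * i + 5)%N, (3 * i + 4)%N.
    have -> : ((i * 8 + 7).-1 = (4 * i + 3) * 2)%N by lia.
    by rewrite mulnK //; ring.
  by move=> x y /(congr1 (fun w => w ^+ t)); rewrite -!exprM ts !pK.
transitivity (\sum_(x : 'F_p) psi (x ^+ (m + 2))).
  apply: eq_bigr => x _.
  transitivity (psi (x ^+ 2)).
    by rewrite /psi expr2 /= !modFp zE ziE expnS expn1.
  have [->|x0] := eqVneq x 0; first by rewrite !expr0n addn2.
  have : (x ^+ m) ^+ 2 == 1.
    apply/eqP; apply: (mulfI x0); rewrite mulr1 -exprM -exprS.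
    have -> : (m * 2 = 1 * p.-1)%N by rewrite /m; lia.
    exact: pK.
  by rewrite exprD sqrf_eq1 => /orP[] /eqP ->; rewrite ?mul1r // mulN1r psiN.
transitivity (\sum_(x : 'F_p) psi x); first by rewrite [RHS](reindex_inj phi_inj).
rewrite -(sum_Fp (fun i => z ^+ i + z^-1 ^+ i) pp) big_split /=.
have z1 : z != 1.
  by rewrite -(prim_order_dvd pz 1) dvdn1; apply/eqP => p1; rewrite p1 in pp.
rewrite !geometric_root_sum ?addr0 ?invr_eq1 ?(prim_expr_order pz) //.
by rewrite exprVn (prim_expr_order pz) invr1.
Qed.

(** Each step lowers the exponent by 2 at the cost of the real factor [p], so an odd exponent ends
    at the prime case. *)
Lemma gauss_sum_prime_power (p e : nat) (z : algC) : prime p -> (p %% 4 = 3)%N -> odd e ->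
  (p ^ e).-primitive_root z -> (gauss_sum (p ^ e) z)^* = - gauss_sum (p ^ e) z.
Proof.
move=> pp p4; have op : odd p by lia.
elim/ltn_ind: e z => -[|[|e]] IH z // oe pz; first exact: gauss_sum_prime.
rewrite gauss_sum_step // rmorphM /= conjC_nat IH ?mulrN //.
  by move: oe => /=; rewrite negbK.
have := dvdn_prim_root pz (m := p ^ e).
have pE : (p ^ e.+2 = p ^ 2 * p ^ e)%N by rewrite -expnD.
by rewrite pE => /(_ (dvdn_mull _ (dvdnn _))); rewrite mulnK // expn_gt0 prime_gt0.
Qed.

(** * Nonexistence of the design *)

Lemma natr_Zp_eq0 (N m : nat) : (m%:R == 0 :> 'I_N.+2) = (N.+2 %| m)%N.
Proof. by rewrite Zp_nat -val_eqE. Qed.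

Lemma intr_Zp_eq0 (N : nat) (m : int) : (m%:~R == 0 :> 'I_N.+2) = (N.+2 %| m)%Z.
Proof.
by case: m => m; rewrite ?NegzE ?rmorphN ?oppr_eq0 /= -?pmulrn natr_Zp_eq0 dvdzE ?abszN.
Qed.

Section ModularCode.
Variables (N' : nat) (P B : finType) (inc : B -> P -> bool) (z : algC).
Local Notation N := (N'.+2).
Hypothesis pz : N.-primitive_root z.
Hypothesis norm_rows : forall x, (N %| (\sum_s (inc x s : int)) - 1)%Z.
Hypothesis inner_rows :
  forall x y, (N %| 2 * (\sum_s (inc x s && inc y s : int)) - 2)%Z.
Hypothesis perp_rows : forall (y : P -> int) (t : int),
  (forall x, (N %| 2 * (\sum_s (inc x s)%:Z * y s - t))%Z) ->
  (N %| \sum_s y s ^+ 2 - t ^+ 2)%Z.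

(** For the character [r -> z^r] of Z/N the product counts the vectors orthogonal to the code, and
    the zero vector is one of them. *)
Lemma gauss_sum_code_gt0 : 0 < gauss_sum N z ^+ #|P| * (gauss_sum N z)^*.
Proof.
pose psi (r : 'I_N) := z ^+ r.
have psiD a b : psi (a + b) = psi a * psi b.
  by rewrite /psi -exprD -[RHS](prim_expr_mod pz).
have psi0 : psi 0 = 1 by rewrite /psi expr0.
have nondeg (a : 'I_N) : a != 0 -> exists b, psi (a * b) != 1.
  move=> a0; exists 1; rewrite mulr1 /psi -(prim_order_dvd pz).
  by rewrite gtnNdvd // lt0n.
pose a x s : 'I_N := (inc x s)%:R.
have intrE (r : 'I_N) : ((r : nat)%:Z)%:~R = r by rewrite -pmulrn natr_Zp.
have rows1 x : \sum_s a x s * a x s = 1.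
  have := norm_rows x; rewrite -intr_Zp_eq0 rmorphB subr_eq0 rmorph_sum /= => /eqP E.
  by apply: etrans E; apply: eq_bigr => s _; rewrite /a; case: (inc x s) => /=; ring.
have rows2 x y : 2 * (\sum_s a x s * a y s) = 2.
  have := inner_rows x y; rewrite -intr_Zp_eq0 rmorphB subr_eq0 rmorphM rmorph_sum /= => /eqP E.
  apply: etrans E; congr (_ * _); apply: eq_bigr => s _.
  by rewrite /a; case: (inc x s); case: (inc y s) => /=; ring.
have perp (y : {ffun P -> 'I_N} * 'I_N) : [forall x, 2 * (\sum_i a x i * y.1 i - y.2) == 0] ->
    \sum_i y.1 i ^+ 2 - y.2 ^+ 2 = 0 :> 'I_N.
  move/forallP => py.
  have := perp_rows (y := fun s => (y.1 s : nat)) (t := (y.2 : nat)).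
  rewrite -intr_Zp_eq0 rmorphB rmorph_sum rmorphXn /= intrE.
  have -> : \sum_i ((y.1 i : nat)%:Z ^+ 2)%:~R = \sum_i y.1 i ^+ 2 :> 'I_N.
    by apply: eq_bigr => i _; rewrite rmorphXn /= intrE.
  move=> H; apply/eqP/H => x; rewrite -intr_Zp_eq0; apply/eqP; rewrite -[RHS](eqP (py x)).
  rewrite rmorphM rmorphB rmorph_sum /= intrE; congr (_ * (_ - _)).
  by apply: eq_bigr => s _; rewrite rmorphM /= intrE.
have := gauss_sum_self_dual psiD psi0 nondeg rows1 rows2 perp.
have gE : \sum_r psi (r ^+ 2) = gauss_sum N z.
  rewrite /gauss_sum big_mkord; apply: eq_bigr => r _.
  by rewrite /psi expr2 /= (prim_expr_mod pz) expnS expn1.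
have gcE : \sum_r psi (- r ^+ 2) = (gauss_sum N z)^*.
  rewrite -gE rmorph_sum; apply: eq_bigr => r _.
  rewrite [RHS](_ : _ = (psi (r ^+ 2))^-1); last first.
    by rewrite /psi rmorphXn /= (conj_unity_root (isT : 0 < N)%N (prim_expr_order pz)) exprVn.
  have : psi (r ^+ 2) * psi (- r ^+ 2) = 1 by rewrite -psiD subrr.
  move=> E; have p0 : psi (r ^+ 2) != 0.
    by apply/eqP => p0; move/eqP: E; rewrite p0 mul0r eq_sym oner_eq0.
  by apply: (mulfI p0); rewrite E mulfV.
rewrite gE gcE => ->; rewrite ltr0n; apply/card_gt0P; exists 0.
rewrite inE; apply/forallP => x; rewrite big1 ?subr0 ?mulr0 // => i _.
by rewrite ffunE mulr0.
Qed.
End ModularCode.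

(** * Parity of squares and a congruence modulo 4 *)

Lemma sqr_parity (x : int) : exists b, x ^+ 2 = x + 2 * b.
Proof.
rewrite (divz_eq x 2); set u := (x %/ 2)%Z.
have [-> | ->] : (x %% 2)%Z = 0 \/ (x %% 2)%Z = 1 by lia.
  by exists (2 * u ^+ 2 - u); ring.
by exists (2 * u ^+ 2 + u); ring.
Qed.

Lemma sum_sqr_parity (T : finType) (f : T -> int) :
  exists b, \sum_x f x ^+ 2 = \sum_x f x + 2 * b.
Proof.
exists (\sum_x ((f x ^+ 2 - f x) %/ 2)%Z).
rewrite mulr_sumr -big_split; apply: eq_bigr => x _ /=.
by have [b ->] := sqr_parity (f x); lia.
Qed.

(* Dividing the second equation by 4 (2 h ^ 2 + 2 h + 1) leaves a congruence mod 4
   that is linear once squares are reduced by [sqr_parity]. *)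
Lemma mod4_descent (g s t b S a : int) : let h := 2 * (2 * g + 1) in
  let K := 2 * h ^+ 2 + 2 * h + 1 in let q := 2 * h + 1 in
  q * K * s = q * (4 * h ^+ 2 + 2 * h + 1) * t + 2 * S ->
  h * K * ((h + 1) * K * (s + 2 * b) - q * t ^+ 2) + ((h + 1) * K * s - q * K * t) ^+ 2
    = (h + 1) * K * 2 ^+ 2 * (S + 2 * a) ->
  (4 %| s + 2 * b - t ^+ 2)%Z.
Proof.
(* In the application [s] and [s + 2 b] are the sum and the sum of squares of a vector, [S] and
   [S + 2 a] those of its halved block deviations. *)
move=> h K q E1 E2; pose G := 2 * g + 1.
have KE : K = 1 + 4 * (2 * G ^+ 2 + G) by rewrite /K /h -/G; ring.
have [d sE] : exists d, s = t + 2 * d.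
  exists (S - (2 * G + q * (4 * G ^+ 2 + 2 * G)) * s + (2 * G + q * (8 * G ^+ 2 + 2 * G)) * t).
  have -> : 2 * (S - (2 * G + q * (4 * G ^+ 2 + 2 * G)) * s
        + (2 * G + q * (8 * G ^+ 2 + 2 * G)) * t) =
     2 * S - (4 * G + q * (K - 1)) * s + (4 * G + q * (16 * G ^+ 2 + 4 * G)) * t.
    by rewrite KE; ring.
  have -> : 2 * S = q * K * s - q * (4 * h ^+ 2 + 2 * h + 1) * t by rewrite E1; ring.
  by rewrite /q /h -/G; ring.
have SE : S = q * (K * d - 4 * G ^+ 2 * t).
  apply: (@mulfI _ 2) => //.
  have -> : 2 * S = q * K * s - q * (4 * h ^+ 2 + 2 * h + 1) * t by rewrite E1; ring.
  by rewrite sE /K /h -/G; ring.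
pose E := (2 * G + 1) * d - G * t.
have E3 : G * ((2 * G + 1) * K * (s + 2 * b) - q * t ^+ 2) + 2 * K * E ^+ 2
     = 2 * (2 * G + 1) * (S + 2 * a).
  have K0 : 2 * K != 0 by rewrite KE; move: (_ + G) => m; lia.
  apply: (mulfI K0).
  transitivity ((h + 1) * K * 2 ^+ 2 * (S + 2 * a)); last by rewrite /h -/G; ring.
  rewrite -E2.
  have -> : (h + 1) * K * s - q * K * t = K * (2 * E) by rewrite sE /E /q /h -/G; ring.
  by rewrite /h -/G; ring.
(* [X1], [X2] and [X3] separate residues modulo 4 from multiples of 4, which become [u1], [u2] and
   [u3]. *)
have [e eE] := sqr_parity E; have [v vE] := sqr_parity t.
have X1 : (2 * G + 1) * K * (s + 2 * b) - q * t ^+ 2 =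
    3 * (t + 2 * d + 2 * b) - (t + 2 * v)
    + 4 * ((g + (4 * g + 3) * (2 * G ^+ 2 + G)) * (t + 2 * d + 2 * b) - G * (t + 2 * v)).
  by rewrite vE sE KE /q /h -/G /G; ring.
have X2 : 2 * K * E ^+ 2 =
    2 * (d + t) + 4 * (((2 * g + 1) * d - (g + 1) * t) + e + 2 * (2 * G ^+ 2 + G) * E ^+ 2).
  by rewrite KE mulrDr mulrDl mulr1 {1}eE {1}/E /G; ring.
have X3 : S = d + 4 * ((2 * G ^+ 2 + G + G * K) * d - q * G ^+ 2 * t).
  by rewrite SE /q /h -/G mulrBr mulrDl mul1r KE; ring.
rewrite X1 X2 X3 /G in E3.
set u1 := (_ - _ * (t + 2 * v)) in E3; set u2 := (_ + _ * E ^+ 2) in E3.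
set u3 := (_ - q * _ * t) in E3; rewrite sE vE.
move: u1 u2 u3 E3 => u1 u2 u3 E3.
(* Halved and read modulo 2, this says that [d + b - v] is even, while the goal concerns
   [2 (d + b - v)]. *)
have : (2 * g + 1) * (2 * t + 6 * d + 6 * b - 2 * v + 4 * u1) + 2 * (d + t) + 4 * u2
    = (8 * g + 6) * (d + 4 * u3 + 2 * a).
  transitivity (2 * (2 * (2 * g + 1) + 1) * (d + 4 * u3 + 2 * a)); last by ring.
  by rewrite -E3; ring.
by clear; lia.
Qed.

Section Design.
Variables (P B : finType) (inc : B -> P -> bool) (h : nat).
Local Notation q := (2 * h + 1)%N.
Local Notation K := (2 * h ^ 2 + 2 * h + 1)%N.
Local Notation c := (4 * h ^ 2 + 2 * h + 1)%N.
Local Notation mu := ((h + 1) * K)%N.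
Hypothesis cP : #|P| = c.
Hypothesis cB : #|B| = (q * c)%N.
Hypothesis point_deg : forall s, (\sum_x inc x s = q * K)%N.
Hypothesis point_pair : forall s t, s != t -> (\sum_x (inc x s && inc x t) = mu)%N.
Hypothesis block_size : forall x, (\sum_s inc x s = K)%N.
Hypothesis block_pair : forall x y, x != y ->
  (\sum_s (inc x s && inc y s) = h ^ 2 + h + 1)%N \/
  (\sum_s (inc x s && inc y s) = (h + 1) ^ 2)%N.

Local Notation A y x := (\sum_s (inc x s)%:Z * y s).

Lemma sum_block_values (y : P -> int) : \sum_x A y x = (q * K)%:Z * \sum_s y s.
Proof.
rewrite exchange_big mulr_sumr; apply: eq_bigr => s _.
by rewrite -mulr_suml -(point_deg s) rmorph_sum.
Qed.

(** The Gram matrix of the points is [h K I + mu J], because [q K = mu + h K]. *)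
Lemma sum_sqr_block_values (y : P -> int) :
  \sum_x A y x ^+ 2 = (h * K)%:Z * (\sum_s y s ^+ 2) + mu%:Z * (\sum_s y s) ^+ 2.
Proof.
transitivity (\sum_s \sum_t y s * y t * ((mu + h * K * (s == t))%N : int)).
  transitivity (\sum_x \sum_s \sum_t y s * y t * ((inc x s && inc x t) : int)).
    apply: eq_bigr => x _; rewrite expr2 mulr_suml; apply: eq_bigr => s _.
    rewrite mulr_sumr; apply: eq_bigr => t _.
    by case: (inc x s); case: (inc x t) => /=; ring.
  rewrite exchange_big; apply: eq_bigr => s _; rewrite exchange_big; apply: eq_bigr => t _.
  rewrite -mulr_sumr -rmorph_sum /=; congr (_ * Posz _).
  have [<-|st] := eqVneq s t; last by rewrite point_pair // muln0 addn0.
  rewrite -[LHS](_ : (\sum_x inc x s)%N = _).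
    by rewrite point_deg muln1; ring.
  by apply: eq_bigr => x _; rewrite andbb.
rewrite expr2 mulr_suml !mulr_sumr -big_split; apply: eq_bigr => s _ /=.
rewrite mulr_sumr [in RHS]mulr_sumr.
rewrite (bigD1 s) //= [in RHS](bigD1 s) //= eqxx addrA; congr (_ + _).
  by rewrite muln1 !PoszD !PoszM; ring.
by apply: eq_bigr => t; rewrite eq_sym => /negbTE ->; rewrite muln0 addn0; ring.
Qed.

(** Multiplying the second-moment equation by [mu] completes the square in [\sum_s y s] and [t]; the
    remaining coefficient of [t ^+ 2] comes from [(h + 1) c = q K - h]. *)
Lemma block_values_identity (y w : P -> int) (t N : int) (v : B -> int) :
  (forall x, A y x = t + N * v x) ->
  (q * K)%:Z * (\sum_s y s) = (q * c)%:Z * t + N * \sum_x v x /\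
  (h * K)%:Z * (mu%:Z * (\sum_s y s ^+ 2) - q%:Z * t ^+ 2)
   + (mu%:Z * (\sum_s y s) - (q * K)%:Z * t) ^+ 2 = mu%:Z * N ^+ 2 * \sum_x v x ^+ 2.
Proof.
move=> Ay.
have E1 : (q * K)%:Z * (\sum_s y s) = (q * c)%:Z * t + N * \sum_x v x.
  rewrite -sum_block_values; under eq_bigr do rewrite Ay.
  by rewrite big_split sumr_const cB -mulr_sumr /= -mulr_natl natz.
split=> //; have := sum_sqr_block_values y.
under eq_bigr do rewrite Ay sqrrD.
rewrite !big_split /= sumr_const cB.
have -> : \sum_x t * (N * v x) = t * ((q * K)%:Z * (\sum_s y s) - (q * c)%:Z * t).
  by rewrite E1 addrAC subrr add0r -!mulr_sumr.
have -> : \sum_x (N * v x) ^+ 2 = N ^+ 2 * \sum_x v x ^+ 2.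
  by rewrite mulr_sumr; apply: eq_bigr => x _; ring.
rewrite -mulr_natl natz.
set Y2 := \sum_s y s ^+ 2; set Y := \sum_s y s; set V := \sum_x v x ^+ 2 => E2.
rewrite -[RHS]mulrA.
have -> : N ^+ 2 * V = (h * K)%:Z * Y2 + mu%:Z * Y ^+ 2 - (q * c)%:Z * t ^+ 2
   - 2 * t * ((q * K)%:Z * Y - (q * c)%:Z * t) by rewrite -E2; ring.
rewrite !(PoszD, PoszM); ring.
Qed.


Lemma sum_block_int x : \sum_s (inc x s : int) = K%:Z.
Proof. by rewrite -(block_size x) rmorph_sum. Qed.

Lemma sum_pair_int x y :
  [\/ \sum_s (inc x s && inc y s : int) = K%:Z,
      \sum_s (inc x s && inc y s : int) = (h ^ 2 + h + 1)%N%:Z |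
      \sum_s (inc x s && inc y s : int) = ((h + 1) ^ 2)%N%:Z].
Proof.
have E (m : nat) : (\sum_s (inc x s && inc y s) = m)%N ->
    \sum_s (inc x s && inc y s : int) = m%:Z by move=> <-; rewrite rmorph_sum.
have [<-|xy] := eqVneq x y.
  by constructor 1; rewrite -(sum_block_int x); apply: eq_bigr => s _; rewrite andbb.
by case: (block_pair xy) => /E; [constructor 2 | constructor 3].
Qed.

Lemma no_design_prime_power (p l e : nat) : prime p -> (p %% 4 = 3)%N -> odd e ->
  odd l -> coprime l p -> h = (l * p ^ e)%N -> False.
Proof.
move=> pp p4 oe ol lp hE.
have op : odd p by lia.
have oN : odd (p ^ e) by rewrite oddX op orbT.
have e0 : (0 < e)%N by case: (e) oe.
have N2 : (1 < p ^ e)%N by rewrite -{1}(exp1n e) ltn_exp2r // prime_gt1.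
have [z pz] := C_prim_root_exists (ltnW N2).
have gN := gauss_sum_prime_power pp p4 oe pz.
have lN : coprimez (p ^ e)%N l by rewrite coprimezE /= coprime_sym coprimeXr.
set N := (p ^ e)%N in oN N2 z pz gN lN hE.
have hz : h%:Z = l%:Z * N%:Z by rewrite hE PoszM.
have Nmod (a : int) : (N %| h%:Z * a)%Z by rewrite hz mulrAC dvdz_mull.
have : 0 < gauss_sum N z ^+ #|P| * (gauss_sum N z)^*.
  move: (N) N2 Nmod lN oN pz hz => [|[|N']] // _ Nmod lN oN pz hz.
  apply: (gauss_sum_code_gt0 (inc := inc) pz).
  - move=> x; rewrite sum_block_int.
    have -> : K%:Z - 1 = h%:Z * (2 * h%:Z + 2) by rewrite !(PoszD, PoszM); ring.
    exact: Nmod.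
  - move=> x y; case: (sum_pair_int x y) => ->.
    + have -> : 2 * K%:Z - 2 = h%:Z * (4 * h%:Z + 4) by rewrite !(PoszD, PoszM); ring.
      exact: Nmod.
    + have -> : 2 * (h ^ 2 + h + 1)%N%:Z - 2 = h%:Z * (2 * h%:Z + 2) by rewrite !(PoszD, PoszM); ring.
      exact: Nmod.
    + have -> : 2 * ((h + 1) ^ 2)%N%:Z - 2 = h%:Z * (2 * h%:Z + 4) by rewrite !(PoszD, PoszM); ring.
      exact: Nmod.
  move=> y t; set M := N'.+2 in lN oN Nmod pz hz * => Ny.
  have c2 : coprimez M 2 by rewrite coprimezE /= coprimen2.
  have Ay x : A y x = t + M%:Z * ((A y x - t) %/ M%:Z)%Z.
    have := Ny x; rewrite Gauss_dvdzr // => /divzK; rewrite mulrC => ->; ring.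
  have [E1 E2] := block_values_identity y Ay.
  set s1 := \sum_s _ in E1 E2; set s2 := \sum_s _ in E2 *.
  set V1 := \sum_x _ in E1; set V2 := \sum_x _ in E2.
  have Kz : K%:Z = 1 + h%:Z * (2 * h%:Z + 2) by rewrite !(PoszD, PoszM); ring.
  have qz : q%:Z = 1 + 2 * h%:Z by rewrite PoszD PoszM addrC.
  have cz : c%:Z = 1 + h%:Z * (4 * h%:Z + 2) by rewrite !(PoszD, PoszM); ring.
  rewrite !(PoszM q) Kz qz cz in E1.
  rewrite !PoszM Kz qz (PoszD h) in E2.
  set H := h%:Z in hz Nmod E1 E2.
  (* Since [M] divides [h], the numbers [K], [q] and [c] are all 1 modulo [M], and [E1] reduces to
     this. *)
  have st : (M %| s1 - t)%Z.
    have -> : s1 - t = M%:Z * V1 - H * ((2 + (1 + 2 * H) * (2 * H + 2)) * s1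
                - (2 + (1 + 2 * H) * (4 * H + 2)) * t).
      have -> : M%:Z * V1 = (1 + 2 * H) * (1 + H * (2 * H + 2)) * s1
          - (1 + 2 * H) * (1 + H * (4 * H + 2)) * t by rewrite E1; ring.
      ring.
    by rewrite rpredB // dvdz_mulr.
  have /dvdzP[d dE] := st.
  set k1 := 2 * H + 2 in E1 E2.
  set X := (_ * s2 - _) in E2.
  (* In [E2] the square and the right side are divisible by [M ^+ 2], and [h = l M]: one factor [M]
     cancels. Then [l] is removed by coprimality, and [K X] is [s2 - t ^+ 2] modulo [M]. *)
  have lX : (M %| l%:Z * ((1 + H * k1) * X))%Z.
    apply/dvdzP; exists ((H + 1) * (1 + H * k1) * V2 -
       (1 + H * k1) ^+ 2 * ((H + 1) * d - l%:Z * t) ^+ 2).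
    have M0 : M%:Z != 0 by [].
    apply: (mulIf M0).
    have sE : s1 = d * M%:Z + t by rewrite -dE; ring.
    transitivity (H * (1 + H * k1) * X); first by rewrite hz; ring.
    have -> : H * (1 + H * k1) * X = (H + 1) * (1 + H * k1) * M%:Z ^+ 2 * V2 -
      ((H + 1) * (1 + H * k1) * s1 - (1 + 2 * H) * (1 + H * k1) * t) ^+ 2 by rewrite -E2; ring.
    have -> : (H + 1) * (1 + H * k1) * s1 - (1 + 2 * H) * (1 + H * k1) * t =
      (1 + H * k1) * M%:Z * ((H + 1) * d - l%:Z * t).
      transitivity ((1 + H * k1) * ((H + 1) * (d * M%:Z) - H * t)); first by rewrite sE; ring.
      by rewrite [X in _ - X * t]hz; ring.
    by ring.
  rewrite Gauss_dvdzr // in lX.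
  have -> : s2 - t ^+ 2 = (1 + H * k1) * X - H * ((1 + (2 * k1 + H * k1 ^+ 2) * (1 + H)) * s2
     - (2 + k1 * (1 + 2 * H)) * t ^+ 2) by rewrite /X; ring.
  by rewrite rpredB.
(* The product is now minus [g^(c+1)]. As [h] is odd, 4 divides [c + 1], and [g^4] is the square of
   the nonnegative [g g^*]. *)
rewrite gN mulrN -exprSr cP.
have [m ->] : exists m, (c.+1 = 4 * m)%N.
  have oh : odd h by rewrite hE oddM ol.
  by exists (h ^ 2 + h.+1 %/ 2)%N; lia.
have -> : gauss_sum N z ^+ (4 * m) = ((gauss_sum N z * (gauss_sum N z)^*) ^+ 2) ^+ m.
  by rewrite gN mulrN sqrrN -expr2 -!exprM.
by rewrite oppr_gt0 => /lt_geF; rewrite !exprn_ge0 // mul_conjC_ge0.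
Qed.

Lemma no_design_mod4 : (h %% 4 = 2)%N -> False.
Proof.
move=> h4; have [g hE] : exists g, h = (4 * g + 2)%N by exists (h %/ 4)%N; lia.
have [z pz] := C_prim_root_exists (isT : 0 < 4)%N.
have : 0 < gauss_sum 4 z ^+ #|P| * (gauss_sum 4 z)^*.
  apply: (gauss_sum_code_gt0 (inc := inc) pz).
  - by move=> x; rewrite sum_block_int; rewrite hE; lia.
  - by move=> x y; case: (sum_pair_int x y) => ->; rewrite hE; lia.
  move=> y t Ny.
  (* The factor 2 in the polar form leaves only a congruence modulo 2, so the deviations are
     halved. *)
  have Ay x : A y x = t + 2 * ((A y x - t) %/ 2)%Z by have := Ny x; lia.
  have [E1 E2] := block_values_identity y Ay.
  have [b bE] := sum_sqr_parity y.
  have [a aE] := sum_sqr_parity (fun x => (A y x - t) %/ 2)%Z.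
  move: E2 E1; rewrite bE aE.
  set V1 := \sum_x (_ %/ _)%Z => E2 E1.
  apply: (mod4_descent (g := g%:Z) (S := V1) (a := a)).
    have -> : 2 * (2 * g%:Z + 1) = h%:Z by rewrite hE; lia.
    by move: E1; rewrite !(PoszD, PoszM).
  have -> : 2 * (2 * g%:Z + 1) = h%:Z by rewrite hE; lia.
  by move: E2; rewrite !(PoszD, PoszM).
have z4 : z ^+ 4 = 1 by exact: prim_expr_order.
have z2 : z ^+ 2 = -1.
  have : z ^+ 2 != 1 by rewrite -(prim_order_dvd pz).
  have : (z ^+ 2) ^+ 2 == 1 by rewrite -exprM z4.
  by rewrite sqrf_eq1 => /orP[->|/eqP].
have gE : gauss_sum 4 z = 2 + 2 * z.
  rewrite /gauss_sum !big_nat_recl // big_geq // (exprM z 2 2) (exprS z 8) (exprM z 2 4) z2.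
  by rewrite expr0 expr1; ring.
have gcE : (gauss_sum 4 z)^* = 2 - 2 * z.
  rewrite gE rmorphD rmorphM /= !conjC_nat (conj_unity_root (isT : 0 < 4)%N z4).
  have -> : z^-1 = - z.
    have z0 : z != 0 by apply/eqP => z0; move: z2; rewrite z0 expr0n => /eqP; rewrite eq_sym oppr_eq0 oner_eq0.
    by apply: (mulfI z0); rewrite mulfV // mulrN -expr2 z2 opprK.
  by rewrite mulrN.
rewrite gcE gE cP.
(* [c = 8 m + 5], so the product is [(-64)^(2 m + 1)] times [g g^* = 8], which is negative. *)
have [m ->] : exists m, c = (4 * (2 * m + 1)).+1.
  by exists (8 * g ^ 2 + 9 * g + 2)%N; rewrite hE; ring.
have g4 : (2 + 2 * z) ^+ 4 = - 64.
  transitivity (16 * (1 + 2 * z + z ^+ 2) ^+ 2); first by ring.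
  by rewrite z2; transitivity (64 * z ^+ 2); [ring | rewrite z2; ring].
rewrite exprSr exprM g4 -mulrA.
have -> : (2 + 2 * z) * (2 - 2 * z) = 8.
  by transitivity (4 - 4 * z ^+ 2); [ring | rewrite z2; ring].
rewrite exprD exprM expr1 sqrrN mulrN mulNr oppr_gt0 => /lt_geF.
by rewrite !mulr_ge0 ?exprn_ge0 ?ler0n.
Qed.

End Design.

Theorem theorem6p1 (q : nat) (n : nat) (e : rel 'I_n) (k lam mu : nat) :
  odd q -> (1 < q)%N ->
  srg e ((q + 1) * (q ^ 2 - q + 1))%N k lam mu ->
  primitive e ->
  let eplus : algC := (q%:R - 1) / 2 in
  let eminus : algC := - (q%:R ^+ 2 + 1) / 2 in
  eigenvalue (adjmx e) eplus ->
  eigenvalue (adjmx e) eminus ->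
  (forall a : algC, eigenvalue (adjmx e) a -> [\/ a = k%:R, a = eplus | a = eminus]) ->
  n%:R * eminus = (eig_mult e eminus)%:R * (eminus - k%:R) ->
  ((q %% 8 = 5)%N \/
   (exists (l p ex : nat), [/\ q = (2 * l * p ^ ex + 1)%N, prime p, (p %% 4 = 3)%N,
        odd ex & [/\ (0 < ex)%N, odd l & coprime l p]]) ->
     forall S : {set 'I_n}, ~ delsarte_coclique e k eminus S)
  /\
  ((3 < q)%N ->
     #|[set S : {set 'I_n} | delsarte_coclique e k eminus S]| <= 2)%N.
Proof.
move=> oq q1 He [_ cc] eplus eminus eig1 eig2 _ _.
(* In terms of [h] the eigenvalues become the integers [h] and [- K]. *)
have [h qE] : exists h, q = (2 * h + 1)%N by exists q./2; lia.
have h0 : (0 < h)%N by lia.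
have vE : ((q + 1) * (q ^ 2 - q + 1) = (2 * h + 2) * (4 * h ^ 2 + 2 * h + 1))%N.
  have -> : (q ^ 2 = 4 * h ^ 2 + 2 * h + q)%N by rewrite qE; ring.
  by rewrite addnK qE; ring.
rewrite vE in He.
have epE : eplus = h%:R by rewrite /eplus qE natrD natrM; field.
have emE : eminus = - (2 * h ^ 2 + 2 * h + 1)%N%:R.
  by rewrite /eminus qE !(natrD, natrM, natrX); field.
rewrite epE in eig1; rewrite emE in eig2; rewrite emE.
clearbody eplus eminus.
split=> [ab S dS | q3].
  have [lamE muE] := two_eigenvalues_params h0 He cc eig1 eig2.
  have [sS kE] := delsarte_params h0 He cc eig1 eig2 dS.
  have /andP[cS _] := dS.
  have [P [B [inc [cP cB pd pp [bs bp]]]]] := delsarte_design h0 He lamE muE cS kE sS.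
  case: ab => [q5 | [l [p [ex [qE' prp p4 oex [_ ol lp]]]]]].
    by apply: (no_design_mod4 cP cB pd pp bs bp); lia.
  by apply: (no_design_prime_power cP cB pd pp bs bp prp p4 oex ol lp); lia.
(* Uniqueness gives at most one, which is stronger than the bound 2. *)
apply: (@leq_trans 1) => //; apply/card_le1_eqP => S T; rewrite !inE => dS dT.
by apply: (delsarte_unique h0 He cc eig1 eig2) => //; lia.
Qed.
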